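(* Let $r\ge k\ge 2$ be integers, and let $H$ be an $r$-uniform hypergraph. If every hyperedge of $H$ intersects at most $$\left\lfloor \frac{k^{r-1}}{e\,(k-1)^r}\right\rfloor$$ other hyperedges, then $H$ admits a $k$-coloring in which each hyperedge contains all colors.
   Context: A hypergraph $H=(V,E)$ consists of a set of vertices $V$ and a collection $E$ of subsets of $V$, called hyperedges. $H$ is $r$-uniform if each hyperedge has size $r$. A $k$-coloring is a map $V\to\{1,\ldots,k\}$; a hyperedge contains all colors if each of the $k$ colors is assigned to at least one of its vertices. $e$ is the base of the natural logarithm. *)

(* Defs.v *)
From HB Require Import structures.
From mathcomp Require Import all_boot all_order all_algebra.
From mathcomp Require Import all_classical all_reals all_analysis.

Set Implicit Arguments.
Unset Strict Implicit.
Unset Printing Implicit Defensive.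

Local Open Scope classical_set_scope.
Local Open Scope card_scope.

(* The vertex set is the whole type [vertex]; neither it nor the set of
   hyperedges is assumed to be finite. *)
Record hypergraph : Type := Hypergraph {
  vertex : Type;
  hyperedge : set (set vertex)
}.

Arguments hyperedge : clear implicits.

Definition uniform (r : nat) (H : hypergraph) : Prop :=
  forall A, hyperedge H A -> A #= `I_r.

Definition other_intersecting (H : hypergraph) (A : set (vertex H)) :
    set (set (vertex H)) :=
  [set B | [/\ hyperedge H B, B <> A & A `&` B !=set0]].

(* The colors 1, ..., k are represented by the elements 0, ..., k-1 of ['I_k]. *)
Definition coloring (k : nat) (H : hypergraph) : Type := vertex H -> 'I_k.

Definition contains_all_colors (k : nat) (H : hypergraph)
    (c : coloring k H) (A : set (vertex H)) : Prop :=
  forall i : 'I_k, exists2 v, A v & c v = i.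

(* Main.v *)
Require Import Defs.
From mathcomp Require Import all_boot all_order all_algebra.

(* The local lemma in its sharp symmetric form: if every event has probability
   at most p and depends on at most d others, then [e p d <= 1] suffices (not
   [e p (d + 1) <= 1]).  Events are counted in a finite space of colorings.
   By induction, an event having at least one neighbor outside S has conditional
   probability at most x = 1/d (1/2 if d = 1) given that no event of S occurs:
   only d - 1 neighbors remain in S, so the bound needed is [p <= x (1 - x)^(d - 1)], which
   holds because [(1 + 1/(d - 1))^(d - 1) < e].  For the last event all d
   neighbors may be in S, and [p < (1 - x)^d] still keeps the conditional
   probability below 1.  Missing a color on an edge has probability at most
   [p = k (1 - 1/k)^r = (k - 1)^r / k^(r - 1)].  When the degree bound is 0 this p
   may exceed 1, but then the edges are pairwise disjoint and are colored one by
   one.  Infinite hypergraphs are reduced to finite sets of edges by taking the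
   limit of partial solutions along an ultrafilter. *)

Set Implicit Arguments.
Unset Strict Implicit.
Unset Printing Implicit Defensive.

Import Order.TTheory GRing.Theory Num.Theory.
Local Open Scope ring_scope.

(** * The local lemma by counting *)

Section LocalLemma.
Variables (R : realFieldType) (Omega E : finType) (bad : E -> {set Omega}).
Variables (nbr : rel E) (d : nat) (p x : R).

Definition avoid (S : {set E}) : {set Omega} :=
  [set w | [forall (e | e \in S), w \notin bad e]].

Lemma avoidS (S S' : {set E}) : S \subset S' -> avoid S' \subset avoid S.
Proof.
move=> /subsetP sSS'; apply/subsetP => w; rewrite !inE => /forall_inP h.
by apply/forall_inP => e /sSS'; exact: h.
Qed.

Lemma avoidU1 (e : E) (S : {set E}) : avoid (e |: S) = avoid S :\: bad e.
Proof.
apply/setP => w; rewrite !inE; apply/forall_inP/andP => [h|[we /forall_inP h] f].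
  split; first by apply: h; rewrite setU11.
  by apply/forall_inP => f fS; apply: h; rewrite setU1r.
by rewrite !inE => /orP[/eqP->//|/h].
Qed.

Lemma card_avoidU1 (e : E) (S : {set E}) :
  #|avoid (e |: S)|%:R = #|avoid S|%:R - #|bad e :&: avoid S|%:R :> R.
Proof.
by rewrite avoidU1 cardsD setIC natrB// subset_leq_card// subsetIr.
Qed.

(** Chain rule: the events of [N] are added one at a time, each keeping at least a fraction [y]. The
    step hypothesis is confined to [S :|: N], where a later induction on size can supply it. *)
Lemma card_avoidU_ge (y : R) (S N : {set E}) : 0 <= y ->
    (forall e (S' : {set E}), e \in N -> S' \subset S :|: N -> e \notin S' ->
       y * #|avoid S'|%:R <= #|avoid (e |: S')|%:R) ->
    [disjoint S & N] ->
  y ^+ #|N| * #|avoid S|%:R <= #|avoid (S :|: N)|%:R.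
Proof.
move=> y0; elim: {N}#|N| {-2}N (erefl #|N|) => [|n IH] N.
  by move=> /cards0_eq -> _ _; rewrite cards0 expr0 mul1r setU0.
move=> cN step dSN.
have /card_gt0P[e eN] : (0 < #|N|)%N by rewrite cN.
have sub : S :|: N :\ e \subset S :|: N by rewrite setUS// subD1set.
have eS : e \notin S by rewrite (disjointFl dSN).
have -> : S :|: N = e |: (S :|: N :\ e) by rewrite setUCA setD1K.
apply: le_trans (step _ _ eN sub _); last by rewrite !inE eqxx/= orbF.
have cN' : #|N :\ e| = n by move: cN; rewrite (cardsD1 e) eN => -[].
rewrite cN exprS -mulrA ler_wpM2l// -cN' IH//.
- move=> f S' /setD1P[_ fN] sS'; apply: step => //.
  exact: subset_trans sub.
- by apply: disjointWr dSN; rewrite subD1set.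
Qed.

Hypothesis nbr_sym : symmetric nbr.
(** [d] is one less than the degree bound: it counts the neighbors left once one is known to lie
    outside the conditioning set. *)
Hypothesis nbr_deg : forall e, (#|[set f | nbr e f]| <= d.+1)%N.
Hypothesis indep : forall e (S : {set E}), e \notin S ->
  (forall f, f \in S -> ~~ nbr e f) ->
  #|bad e :&: avoid S|%:R <= p * #|avoid S|%:R.
Hypotheses (p_ge0 : 0 <= p) (x_gt0 : 0 < x) (x_le : x <= 1 - x).
Hypothesis p_lt : p < x * (1 - x) ^+ d.

Let y_gt0 : 0 < 1 - x. Proof. exact: lt_le_trans x_gt0 x_le. Qed.
Let y_le1 : 1 - x <= 1. Proof. by rewrite gerBl ltW. Qed.

(** A conditional probability bound with denominators cleared. The numerator only grows when the
    neighbors [N] of [e] in [S] are forgotten, and then [indep] applies; the denominator loses at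
    most a factor [1 - x] per neighbor. *)
Lemma card_bad_avoid_le (S : {set E}) (e : E) : e \notin S ->
  (1 - x) ^+ #|[set f in S | nbr e f]| * #|bad e :&: avoid S|%:R
    <= p * #|avoid S|%:R.
Proof.
elim: {S}#|S|.+1 {-2}S (ltnSn #|S|) e => // n IH S.
rewrite ltnS => cS e eS.
set N := [set f in S | _].
have defS : S :\: N :|: N = S.
  by apply/setP => f; rewrite !inE; case: (f \in S); case: (nbr e f).
have dN : [disjoint S :\: N & N] by rewrite -setI_eq0 setIC setIDA setDIl setDv set0I.
apply: (@le_trans _ _ ((1 - x) ^+ #|N| * (p * #|avoid (S :\: N)|%:R))).
  rewrite ler_pM2l ?exprn_gt0//.
  apply: (@le_trans _ _ #|bad e :&: avoid (S :\: N)|%:R).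
    by rewrite ler_nat subset_leq_card// setIS// avoidS// subsetDl.
  apply: indep => [|f]; first by rewrite !inE (negPf eS) andbF.
  by rewrite !inE => /andP[/nandP[/negPf->|//]].
rewrite mulrCA ler_wpM2l//.
rewrite -[in leRHS]defS card_avoidU_ge//; first exact: ltW.
move=> f S'; rewrite defS => fN sS' fS'.
move: fN; rewrite !inE => /andP[fS ef].
have eS' : e \notin S' by apply: contra eS; exact: (subsetP sS').
have /IH/(_ f fS') bf : (#|S'| < n)%N.
  apply: leq_trans cS; apply: proper_card; apply/properP; split => //.
  by exists f.
suff : #|bad f :&: avoid S'|%:R <= x * #|avoid S'|%:R :> R.
  by rewrite card_avoidU1 mulrBl mul1r lerD2l lerN2.
(* [e] is a neighbor of [f] outside [S'], so at most [d] neighbors of [f] lie in [S']. *)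
have /(ler_wiXn2l _ _) mon : (#|[set g in S' | nbr f g]| <= d)%N.
  rewrite -ltnS; apply: leq_trans (nbr_deg f); apply: proper_card.
  apply/properP; split; first by apply/subsetP => g; rewrite !inE => /andP[].
  by exists e; rewrite !inE ?(negPf eS')// nbr_sym.
rewrite -(ler_pM2l (exprn_gt0 d y_gt0)).
apply: (@le_trans _ _ (p * #|avoid S'|%:R)).
  apply: le_trans bf; rewrite ler_wpM2r//.
  by apply: mon => //; exact: ltW.
by rewrite mulrA ler_wpM2r// mulrC ltW.
Qed.

Lemma local_lemma (S : {set E}) : (0 < #|Omega|)%N -> (0 < #|avoid S|)%N.
Proof.
move=> Omega_gt0; elim: {S}#|S| {-2}S (erefl #|S|) => [|n IH] S cS.
  suff -> : avoid S = setT by rewrite cardsT.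
  apply/setP => w; rewrite !inE; apply/forall_inP => e.
  by rewrite (cards0_eq cS) inE.
have /card_gt0P[e eS] : (0 < #|S|)%N by rewrite cS.
rewrite -(setD1K eS) -(ltr_nat R) card_avoidU1 subr_gt0.
have : (0 < #|avoid (S :\ e)|)%N.
  by apply: IH; move: cS; rewrite (cardsD1 e) eS => -[].
rewrite -(ltr_nat R) => Spos.
have := @card_bad_avoid_le (S :\ e) e; rewrite !inE eqxx => /(_ isT) be.
rewrite -(ltr_pM2l (exprn_gt0 d.+1 y_gt0)).
apply: (@le_lt_trans _ _ (p * #|avoid (S :\ e)|%:R)).
  apply: le_trans be; rewrite ler_wpM2r// ler_wiXn2l ?(ltW y_gt0)//.
  apply: leq_trans (nbr_deg e); apply: subset_leq_card.
  by apply/subsetP => g; rewrite !inE => /andP[].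
(* [x <= 1 - x] turns [p_lt] into [p < (1 - x) ^+ d.+1]. *)
rewrite ltr_pM2r//; apply: (lt_le_trans p_lt).
by rewrite exprS ler_wpM2r ?(ltW (exprn_gt0 d y_gt0)).
Qed.

End LocalLemma.

(** * Counting colorings that miss a color *)

Section FfunCounting.
Variables V C : finType.
Implicit Types (c : {ffun V -> C}) (G : {set {ffun V -> C}}) (v : V) (a b : C).

Definition ffun_upd c v a : {ffun V -> C} := [ffun u => if u == v then a else c u].

(** As an event, [G] does not depend on the color of [v]. *)
Definition upd_closed G v := forall c a, c \in G -> ffun_upd c v a \in G.

(** Overwriting the value at [v] injects any fiber into any other, so all fibers have the same
    size. *)
Lemma card_fiber G v a :
  upd_closed G v -> (#|C| * #|[set c in G | c v == a]|)%N = #|G|.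
Proof.
move=> Gv; rewrite -[RHS]sum1_card (partition_big (fun c => c v) predT)//=.
have fiber_le a' b : (#|[set c in G | c v == a']| <= #|[set c in G | c v == b]|)%N.
  rewrite -(@card_in_imset _ _ (fun c => ffun_upd c v b) [set c in G | c v == a']).
    apply/subset_leq_card/subsetP => _ /imsetP[c + ->].
    by rewrite !inE ffunE !eqxx andbT => /andP[/Gv].
  move=> c c'; rewrite !inE => /andP[_ /eqP ca] /andP[_ /eqP c'a] /ffunP eq_cc'.
  apply/ffunP => u; have := eq_cc' u; rewrite !ffunE.
  by case: eqVneq => [->|]; rewrite ?ca ?c'a.
rewrite (eq_bigr (fun=> #|[set c in G | c v == a]|)); last first.
  move=> b _; rewrite sum1dep_card.
  by apply/eqP; rewrite eqn_leq !fiber_le.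
by rewrite sum_nat_const.
Qed.

(** Each vertex [v] of [A] contributes a factor [(#|C| - 1) / #|C|] by [card_fiber], since the event
    imposed by [G] and the other vertices does not depend on the color of [v]. *)
Lemma card_missing (a : C) (A : {set V}) G :
    (forall v, v \in A -> upd_closed G v) ->
  (#|C| ^ #|A| * #|[set c in G | [forall (v | v \in A), c v != a]]|)%N =
  (#|C|.-1 ^ #|A| * #|G|)%N.
Proof.
elim: {A}#|A| {-2}A (erefl #|A|) => [|n IH] A cA Gv.
  rewrite cA !expn0 !mul1n; apply: eq_card => c; rewrite !inE andbC.
  suff -> : [forall (v | v \in A), c v != a] by [].
  by apply/forall_inP => v; rewrite (cards0_eq cA) inE.
have /card_gt0P[v vA] : (0 < #|A|)%N by rewrite cA.
set G' := [set c in G | [forall (u | u \in A :\ v), c u != a]].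
have G'v : upd_closed G' v.
  move=> c b; rewrite !inE => /andP[cG /forall_inP ca].
  rewrite Gv//; apply/forall_inP => u uA; have := ca u uA.
  by move: uA; rewrite !inE ffunE => /andP[/negPf->].
have -> : [set c in G | [forall (u | u \in A), c u != a]] =
    G' :\: [set c in G' | c v == a].
  apply/setP => c; rewrite !inE; case: (c \in G) => //=.
  apply/forall_inP/andP => [ca|[+ /forall_inP ca] u uA].
    split; first by rewrite (negPf (ca v vA)) andbF.
    by apply/forall_inP => u /setD1P[_]; exact: ca.
  have [->|uv] := eqVneq u v; last by move=> _; apply: ca; rewrite !inE uv.
  by rewrite negb_and => /orP[/negP[]|//]; apply/forall_inP.
have cA' : #|A :\ v| = n by move: cA; rewrite (cardsD1 v) vA => -[].
have := IH _ cA' (fun u uA => Gv u (subsetP (subD1set A v) u uA)).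
rewrite -/G' cA' => eqG'.
rewrite cardsD (setIidPr _); last by apply/subsetP => c; rewrite inE => /andP[].
rewrite cA !expnS -[RHS]mulnA -eqG' [RHS]mulnCA -mulnA mulnCA mulnBr.
by rewrite (card_fiber a G'v) -subn1 [in RHS]mulnBl mul1n.
Qed.

End FfunCounting.

(** * Coloring a finite hypergraph *)

Section FiniteColoring.
Variables (R : realFieldType) (V E : finType) (A : E -> {set V}) (r k d : nat).
Hypotheses (k_ge2 : (2 <= k)%N) (r_gek : (k <= r)%N).
Hypothesis A_unif : forall e, #|A e| = r.
Hypothesis A_deg : forall e, (#|[set f | (f != e) && (A e :&: A f != set0)]| <= d)%N.

Lemma disjoint_coloring : d = 0 ->
  exists c : {ffun V -> 'I_k}, forall e i, exists2 v, v \in A e & c v = i.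
Proof.
move=> d0; have disjA e f v : v \in A e -> v \in A f -> f = e.
  move=> ve vf; apply/eqP/negPn/negP => fe.
  have := A_deg e; rewrite d0 leqn0 => /eqP/cards0_eq/setP/(_ f).
  by rewrite !inE fe /= => /negbT/negP[]; apply/set0Pn; exists v; rewrite inE ve.
have k_gt0 : (0 < k)%N by apply: leq_trans k_ge2.
(* The edges are disjoint, so a vertex can take its position in its own edge as color, and [k <= r]
   makes every color occur. Positions from [k] on, and vertices in no edge, default to color 0. *)
pose c := [ffun v => insubd (Ordinal k_gt0)
  (if [pick e | v \in A e] is Some e then index v (enum (A e)) else 0)].
exists c => e i; have ir : (i < size (enum (A e)))%N.
  by rewrite -cardE A_unif (leq_trans (ltn_ord i)).
have /card_gt0P[v0 _] : (0 < #|A e|)%N by rewrite cardE (leq_trans _ ir).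
have vA : nth v0 (enum (A e)) i \in A e by rewrite -mem_enum mem_nth.
exists (nth v0 (enum (A e)) i) => //.
apply: val_inj; rewrite ffunE; case: pickP => [f vf|/(_ e)]; last by rewrite vA.
by rewrite (disjA _ _ _ vA vf) index_uniq ?enum_uniq// val_insubd ltn_ord.
Qed.

Lemma finite_coloring (n : nat) (x : R) : d = n.+1 -> 0 < x -> x <= 1 - x ->
    (k%:R - 1) ^+ r / k%:R ^+ r.-1 < x * (1 - x) ^+ n ->
  exists c : {ffun V -> 'I_k}, forall e i, exists2 v, v \in A e & c v = i.
Proof.
move=> dE x_gt0 x_le; set p : R := _ / _ => p_lt.
pose bad e :=
  [set c : {ffun V -> 'I_k} | [exists i, [forall (v | v \in A e), c v != i]]].
have k_gt0 : (0 < k)%N by exact: leq_trans k_ge2.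
have r_gt0 : (0 < r)%N by exact: leq_trans r_gek.
have kR_gt0 : 0 < k%:R :> R by rewrite ltr0n.
have p_ge0 : 0 <= p by rewrite divr_ge0 ?exprn_ge0 ?subr_ge0 ?ler1n.
pose nbr := [rel e f | (f != e) && (A e :&: A f != set0)].
have nbr_sym : symmetric nbr by move=> e f; rewrite /= eq_sym setIC.
have indep e (S : {set E}) : e \notin S -> (forall f, f \in S -> ~~ nbr e f) ->
    #|bad e :&: avoid bad S|%:R <= p * #|avoid bad S|%:R.
  move=> eS Se; set G := avoid bad S.
  (* A vertex of [A e] lies in no edge of [S], so recoloring it does not affect [G]. *)
  have Ginv v : v \in A e -> upd_closed G v.
    move=> ve c a; rewrite !inE => /forall_inP cG; apply/forall_inP => f fS.
    have vf : v \notin A f.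
      have := Se f fS; rewrite /= negb_and negbK; case: eqVneq => [fe _|_ /= ef].
        by rewrite -fe fS in eS.
      apply/negP => vf; move/negP: ef; apply; apply/set0Pn.
      by exists v; rewrite inE ve.
    have := cG f fS; rewrite !inE; apply: contra => /existsP[i /forall_inP ci].
    apply/existsP; exists i; apply/forall_inP => u uf; have := ci u uf.
    by rewrite ffunE; case: (eqVneq u v) => // uv; rewrite uv (negPf vf) in uf.
  have union : (#|bad e :&: G| <=
      \sum_(i < k) #|[set c in G | [forall (v | v \in A e), c v != i]]|)%N.
    apply: (@leq_trans #|\bigcup_(i < k) [set c in G | [forall (v | v \in A e), c v != i]]|);
      last first.
      elim/big_rec2: _ => [|i m B _ BM]; first by rewrite cards0.
      by apply: leq_trans (leq_card_setU _ _) _; rewrite leq_add2l.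
    apply/subset_leq_card/subsetP => c; rewrite !inE => /andP[/existsP[i ci] cG].
    by apply/bigcupP; exists i => //; rewrite !inE cG.
  have : (k ^ r * #|bad e :&: G| <= k * (k.-1 ^ r * #|G|))%N.
    apply: (leq_trans (leq_mul (leqnn _) union)); rewrite big_distrr/=.
    rewrite -[k in (k * (_ * _))%N]card_ord -sum_nat_const leq_sum// => i _.
    have := @card_missing _ _ i (A e) G Ginv.
    by rewrite card_ord A_unif => ->.
  rewrite -(ler_nat R) !natrM !natrX -subn1 natrB//.
  (* The factor [k] from the union bound over colors cancels one factor of [k ^ r], hence the
     exponent [r.-1] in [p]. *)
  rewrite -[in k%:R ^+ r](prednK r_gt0) exprS -mulrA ler_pM2l// => le_bad.
  by rewrite /p mulrAC ler_pdivlMr ?exprn_gt0// mulrC.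
have [c cE] : exists c, c \in avoid bad [set: E].
  apply/card_gt0P; apply: (@local_lemma R _ _ bad nbr n p x) => //.
  - by move=> e; rewrite -dE; exact: A_deg.
  - by rewrite card_ffun card_ord expn_gt0 k_gt0.
exists c => e i; move: cE; rewrite inE => /forall_inP/(_ e (in_setT _)).
rewrite inE negb_exists => /forallP/(_ i); rewrite negb_forall_in.
by move=> /exists_inP[v ve]; rewrite negbK => /eqP; exists v.
Qed.

End FiniteColoring.

From mathcomp Require Import all_classical all_reals all_analysis.
From mathcomp Require Import lra ring.
Import Order.TTheory GRing.Theory Num.Theory.
Local Open Scope classical_set_scope.
Local Open Scope card_scope.
Local Open Scope ring_scope.

(** * Numerical estimates for the choice of [x] *)

Lemma exp_lower_bound (R : realType) (m : nat) : (0 < m)%N ->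
  (1 + m%:R^-1) ^+ m < expR 1 :> R.
Proof.
move=> m_gt0; have mN0 : m%:R != 0 :> R by rewrite pnatr_eq0 -lt0n.
rewrite -[X in expR X](mulfV mN0) expRM_natl.
rewrite ltr_pXn2r// ?nnegrE ?expR_ge0 ?addr_ge0 ?invr_ge0//.
by rewrite expR_gt1Dx// invr_eq0.
Qed.

Lemma lll_threshold (R : realType) (d : nat) (p : R) :
    p <= (expR 1 * d.+1%:R)^-1 ->
  exists x, [/\ 0 < x, x <= 1 - x & p < x * (1 - x) ^+ d].
Proof.
move=> p_le; have e_gt0 : 0 < expR 1 :> R by rewrite expR_gt0.
case: d p_le => [|m] p_le.
  (* [1 / d.+1] would be 1 here, violating [x <= 1 - x]; with 1/2 the strict bound reduces to
     [e > 2]. *)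
  exists 2^-1; split; rewrite ?invr_gt0//; first lra.
  rewrite expr0 mulr1; apply: le_lt_trans p_le _.
  rewrite mulr1 ltf_pV2 ?posrE//.
  by have := @expR_gt1Dx R 1 (oner_neq0 R); lra.
have d_gt0 : 0 < m.+2%:R :> R by [].
exists m.+2%:R^-1; split; rewrite ?invr_gt0//.
  by rewrite lerBrDr -mulr2n -[_ *+ 2]mulr_natl ler_pdivrMr// mul1r ler_nat.
apply: le_lt_trans p_le _.
rewrite invfM mulrC ltr_pM2l ?invr_gt0//.
have y_gt0 : 0 < 1 - m.+2%:R^-1 :> R.
  by rewrite subr_gt0 invf_lt1// ltr1n.
rewrite -[ltRHS]invrK -exprVn ltf_pV2 ?posrE ?exprn_gt0 ?invr_gt0//.
suff -> : (1 - m.+2%:R^-1)^-1 = 1 + m.+1%:R^-1 :> R by exact: exp_lower_bound.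
have t_gt0 : 0 < m.+1%:R :> R by [].
rewrite -natr1; move: m.+1%:R t_gt0 => t t_gt0.
by field; rewrite gt_eqF// gt_eqF// -?addrA ?addr_gt0.
Qed.

(** * Passing between sets and finite types *)

Lemma card_eq_enum (T : Type) (A : set T) n : A #= `I_n ->
  exists2 g : 'I_n -> T, injective g & range g = A.
Proof.
move=> An; have : [set: 'I_n] #= A.
  by apply: card_esym; apply: (card_eq_trans An); exact: card_II.
move=> /card_bijP[f [f' fK f'K]].
have iT (i : 'I_n) : i \in [set: 'I_n] by rewrite inE.
exists (fun i => set_val (f (SigSub (iT i)))).
  by move=> i j /val_inj/(can_inj fK)/(congr1 val).
apply/seteqP; split=> [_ [i _ <-]|v Av]; first exact: set_valP.
exists (val (f' (SigSub (mem_set Av)))) => //.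
set u := f' _; have -> : SigSub (iT (val u)) = u by exact: val_inj.
by rewrite f'K.
Qed.

Lemma card_eq_preimage (I : finType) (T : Type) (g : I -> T) (A : set T) :
  injective g -> A `<=` range g -> A #= `I_#|[pred i | `[< A (g i) >]]|.
Proof.
move=> g_inj Ag; set S := [pred i | _].
rewrite (_ : A = (g \o enum_val) @` [set: 'I_#|S|]).
  rewrite (card_eql (inj_card_eq _)); first by rewrite card_eq_sym card_II.
  by move=> i j _ _ /g_inj/enum_val_inj.
apply/seteqP; split=> [v Av|_ [i _ <-]]; last first.
  by move: (enum_valP i); rewrite unfold_in => /asboolP.
have [i _ gi] := Ag v Av; have iS : i \in S by rewrite unfold_in; apply/asboolP; rewrite gi.
by exists (enum_rank_in iS i) => //=; rewrite enum_rankK_in.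
Qed.

Lemma card_le_preimage (I : finType) (T : Type) (g : I -> T) (A : set T) n :
  injective g -> A #<= `I_n -> (#|[pred i | `[< A (g i) >]]| <= n)%N.
Proof.
move=> g_inj An; rewrite -card_le_II.
have /(card_eq_preimage g_inj) eqA : A `&` range g `<=` range g by move=> v [].
rewrite (_ : #|[pred i | `[< A (g i) >]]| = #|[pred i | `[< (A `&` range g) (g i) >]]|).
  rewrite -(card_le_eql eqA); apply: card_le_trans An.
  by apply: subset_card_le => v [].
apply: eq_card => i; rewrite !inE; apply: asbool_equiv_eq.
by split=> [?|[]//]; split=> //; exists i.
Qed.

(** * Compactness *)

Lemma coloring_compactness (H : hypergraph) (k : nat) :
    (forall A, hyperedge H A -> finite_set A) ->
    (forall F : set (set (vertex H)), finite_set F -> F `<=` hyperedge H ->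
       exists c : coloring k H, forall A, F A -> contains_all_colors c A) ->
  exists c : coloring k H, forall A, hyperedge H A -> contains_all_colors c A.
Proof.
move=> Hfin Fcol.
pose good (F : set (set (vertex H))) :=
  [set c : coloring k H | forall A, F A -> contains_all_colors c A].
pose finE : set (set (set (vertex H))) := [set F | finite_set F /\ F `<=` hyperedge H].
(* Unions of finite families make the sets [good F] a filter base; finite colorability makes the
   filter proper. *)
have fprop : ProperFilter (filter_from finE good).
  apply: filter_from_proper; last by move=> F [Ff FH]; exact: Fcol.
  apply: filter_from_filter; first by exists set0; split.
  move=> F F' [Ff FH] [F'f F'H]; exists (F `|` F').
    by split; [rewrite finite_setU|move=> A [/FH|/F'H]].
  by move=> c cFF'; split=> A ?; apply: cFF'; [left|right].
have [U [Uultra sU]] := ultraFilterLemma fprop.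
(* There are only [k] colors: if none of these sets were in [U], all their complements would be, and
   so would their empty intersection. *)
have Uc v : exists i, U [set c : coloring k H | c v = i].
  apply: contrapT => /forallNP nU.
  have : U [set c : coloring k H | forall i, c v <> i].
    apply: filter_forall => i.
    by have [/nU|] := in_ultra_setVsetC [set c : coloring k H | c v = i] Uultra.
  by move=> /filter_ex[c /(_ (c v))].
have {Uc}[c Uc] := choice Uc.
exists c => A HA i; have /finite_setP[n /card_eq_enum[g g_inj gA]] := Hfin A HA.
(* As the edge is finite, [U]-almost all colorings agree with [c] on all of it, and one of these
   also lies in [good [set A]]. *)
have Ug : U [set c' : coloring k H | forall j, c' (g j) = c (g j)].
  by apply: filter_forall => j; exact: Uc.
have UA : U (good [set A]).
  by apply: sU; exists [set A] => //; split=> // _ ->.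
have [c' [c'c /(_ A erefl i)[v Av <-]]] := filter_ex (filterI Ug UA).
by exists v => //; move: Av; rewrite -gA => -[j _ <-].
Qed.

(* [Num.truncn] is the floor, as a natural number, of a nonnegative real. *)
Theorem theorem13 (R : realType) (r k : nat) (H : hypergraph)
    (k_ge2 : (2 <= k)%N) (r_gek : (k <= r)%N) (H_unif : uniform r H)
    (H_deg : forall A, hyperedge H A ->
       other_intersecting A #<=
         `I_(Num.truncn (k%:R ^+ r.-1 / (expR 1 * (k%:R - 1) ^+ r) : R))) :
  exists c : coloring k H,
    forall A, hyperedge H A -> contains_all_colors c A.
Proof.
have k_gt0 : (0 < k)%N by exact: leq_trans k_ge2.
have k1_gt0 : 0 < k%:R - 1 :> R by rewrite subr_gt0 ltr1n.
have Hfin A : hyperedge H A -> finite_set A.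
  by move=> HA; apply/finite_setP; exists r; exact: H_unif.
apply: coloring_compactness => // F Ffin FH.
have [m /card_eq_enum[e e_inj eF]] := (finite_setP F).1 Ffin.
have He j : hyperedge H (e j) by apply: FH; rewrite -eF; exists j.
(* Only the finitely many vertices on edges of [F] matter, so vertices and edges can be indexed by
   ordinals. *)
have [n /card_eq_enum[g g_inj gF]] : exists n, \bigcup_(A in F) A #= `I_n.
  by apply/finite_setP; apply: bigcup_finite => // A /FH; exact: Hfin.
have eg j : e j `<=` range g.
  by rewrite gF => v ev; exists (e j) => //; rewrite -eF; exists j.
pose A j : {set 'I_n} := finset (fun i => `[< e j (g i) >]).
have memA j i : (i \in A j) = `[< e j (g i) >] by rewrite finset.inE.
have A_unif j : #|A j| = r.
  rewrite cardsE; apply/card_eq_II.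
  apply: card_eq_trans (H_unif _ (He j)).
  by rewrite card_eq_sym; exact: card_eq_preimage g_inj (eg j).
have A_deg j : (#|finset (fun l => (l != j) && (A j :&: A l != finset.set0)%SET)| <=
    Num.truncn (k%:R ^+ r.-1 / (expR 1 * (k%:R - 1) ^+ r) : R))%N.
  rewrite cardsE; apply: leq_trans (card_le_preimage e_inj (H_deg _ (He j))).
  apply/subset_leq_card/fintype.subsetP => l.
  rewrite !unfold_in => /andP[lj /finset.set0Pn[i]].
  rewrite finset.inE !memA => /andP[/asboolP ij /asboolP il].
  apply/asboolP; split; [exact: He| |by exists (g i)].
  by move=> /e_inj lj'; rewrite lj' eqxx in lj.
have [c cA] : exists c : {ffun 'I_n -> 'I_k},
    forall j i, exists2 v, v \in A j & c v = i.
  move: A_deg; set d := Num.truncn _.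
  have : d%:R <= k%:R ^+ r.-1 / (expR 1 * (k%:R - 1) ^+ r) :> R.
    by rewrite truncn_le divr_ge0// mulr_ge0// ?expR_ge0// exprn_ge0// ltW.
  case: d => [|d] d_le A_deg; first exact: (disjoint_coloring k_ge2 r_gek A_unif A_deg).
  have /lll_threshold[x [x_gt0 x_le p_lt]] :
      (k%:R - 1) ^+ r / k%:R ^+ r.-1 <= (expR 1 * d.+1%:R)^-1 :> R.
    have e_gt0 : 0 < expR 1 :> R by exact: expR_gt0.
    rewrite -[leLHS]invrK lef_pV2 ?posrE ?mulr_gt0 ?invr_gt0 ?divr_gt0 ?exprn_gt0 ?ltr0n//.
    by rewrite mulrC -ler_pdivlMr// invf_div -mulrA -invfM [_ * expR 1]mulrC.
  exact: (finite_coloring k_ge2 r_gek A_unif A_deg erefl x_gt0 x_le p_lt).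
(* Vertices on no edge of [F] get an arbitrary color. *)
exists (fun v => if [pick i | `[< g i = v >]] is Some i then c i else Ordinal k_gt0).
move=> B; rewrite -eF => -[j _ <-] i; have [v + cv] := cA j i.
rewrite memA => /asboolP ev; exists (g v) => //.
case: pickP => [u /asboolP/g_inj -> //|/(_ v)/asboolP[]//].
Qed.
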